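(* Let $X_n$ be the unitary Cayley graph of order $n$. Then $L^2(X_n)=L(L(X_n))$ is strongly regular if and only if $n=4$.
   Context: The unitary Cayley graph $X_n$ is the graph with vertex set $\mathbb{Z}_n=\{0,1,\ldots,n-1\}$ in which $i$ and $j$ are adjacent if and only if $\gcd(i-j,n)=1$. The line graph $L(G)$ of a graph $G$ has the edges of $G$ as vertices, two being adjacent if the corresponding edges share a vertex; $L^2(G)=L(L(G))$. A strongly regular graph is a connected regular graph whose adjacency matrix has exactly three distinct eigenvalues. *)

(* Defs.v *)
From HB Require Import structures.
From mathcomp Require Import all_boot all_order all_algebra.

Set Implicit Arguments.
Unset Strict Implicit.
Unset Printing Implicit Defensive.

Import Order.TTheory GRing.Theory Num.Theory.
Local Open Scope ring_scope.

Record sgraph := SGraph {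
  vertex :> finType;
  adj : rel vertex;
  adj_sym : symmetric adj;
  adj_irrefl : irreflexive adj
}.

Section UnitaryCayley.
Variable n : nat.

(* The vertex type is 'I_n rather than 'Z_n, since 'Z_1 has two elements. The
   conjunct i != j only matters for n = 1, where gcd(0, 1) = 1 would give a
   loop. *)
Definition unitary_cayley_adj : rel 'I_n :=
  fun i j => (i != j) && (gcdz (i%:Z - j%:Z) n%:Z == 1).

Lemma unitary_cayley_adj_sym : symmetric unitary_cayley_adj.
Proof.
by move=> i j; rewrite /unitary_cayley_adj eq_sym -opprB /gcdz abszN.
Qed.

Lemma unitary_cayley_adj_irrefl : irreflexive unitary_cayley_adj.
Proof. by move=> i; rewrite /unitary_cayley_adj eqxx. Qed.

Definition unitary_cayley : sgraph :=
  SGraph unitary_cayley_adj_sym unitary_cayley_adj_irrefl.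

End UnitaryCayley.

Section LineGraph.
Variable G : sgraph.

Definition edges : {set {set G}} :=
  [set e : {set G} | [exists x, exists y, adj x y && (e == [set x; y])]].

Definition edge : finType := {e : {set G} | e \in edges}.

Definition line_adj : rel edge :=
  fun e f => (e != f) && (val e :&: val f != set0).

Lemma line_adj_sym : symmetric line_adj.
Proof. by move=> e f; rewrite /line_adj eq_sym setIC. Qed.

Lemma line_adj_irrefl : irreflexive line_adj.
Proof. by move=> e; rewrite /line_adj eqxx. Qed.

Definition line_graph : sgraph := SGraph line_adj_sym line_adj_irrefl.

End LineGraph.

Definition connected (G : sgraph) : Prop :=
  (0 < #|G|)%N /\ forall u v : G, connect (@adj G) u v.

Definition regular (G : sgraph) : Prop :=
  exists k : nat, forall u : G, #|[set v | adj u v]| = k.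

Definition adjacency_mx (F : fieldType) (G : sgraph) : 'M[F]_#|G| :=
  \matrix_(i, j) (adj (enum_val i) (enum_val j))%:R.

Definition has_distinct_eigenvalues (F : fieldType) (m : nat) (A : 'M[F]_m)
    (k : nat) : Prop :=
  exists s : seq F, [/\ uniq s, size s = k & forall a, eigenvalue A a = (a \in s)].

Definition strongly_regular (F : fieldType) (G : sgraph) : Prop :=
  [/\ connected G, regular G & has_distinct_eigenvalues (adjacency_mx F G) 3].

(* Main.v *)
(** For a [k]-regular graph [G] with incidence map [N], one has
    [N^T N = k + A(G)] and [N N^T = 2 + A(L(G))]. Hence an eigenvalue [a <> -k]
    of [G] yields the eigenvalue [a + k - 2] of [L(G)], and a nonzero edge
    weighting with zero sum at every vertex (for instance the alternating one on
    an even cycle) yields the eigenvalue [-2].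

    If [n > 4] and [n <> 6], there is a unit [b] with [1 < b < n - 1], so that
    [X_n] has degree [k >= 3] and contains the 4-cycle [0, 1, b + 1, b]. Moreover
    [X_n] has an eigenvalue [a] other than [k] and [-k], and then [4k - 6],
    [a + 3k - 6], [2k - 6] and [-2] are four distinct eigenvalues of [L^2(X_n)].
    If [n] is 3, 4 or 6, then [X_n], and hence [L^2(X_n)], is the cycle of length
    [n]; if [n <= 2], then [L^2(X_n)] has no vertex. *)

Require Import Defs.
From mathcomp Require Import all_boot all_order all_algebra.
From mathcomp Require Import spectral sesquilinear ring zify.

Set Implicit Arguments.
Unset Strict Implicit.
Unset Printing Implicit Defensive.

Import Order.TTheory GRing.Theory Num.Theory.
Local Open Scope ring_scope.

(** * Eigenvalues of adjacency matrices *)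

(** Eigenvectors become functions on the vertices, free of the enumeration that indexes the
    matrix. *)
Lemma eigenvalue_adjacencyP (F : fieldType) (G : sgraph) (a : F) :
  reflect (exists2 x : G -> F, (exists v, x v != 0) &
             forall v, \sum_(u | adj v u) x u = a * x v)
          (eigenvalue (adjacency_mx F G) a).
Proof.
have adj_sum (x : G -> F) v : \sum_(u | adj v u) x u =
    \sum_j x (enum_val j) * adjacency_mx F G j (enum_rank v).
  rewrite big_mkcond /= (reindex (@enum_val G predT)); last first.
    by apply: onW_bij; exact: enum_val_bij.
  apply: eq_bigr => j _; rewrite mxE enum_rankK adj_sym.
  by case: adj; rewrite ?mulr1 ?mulr0.
apply: (iffP eigenvalueP) => [[y yA y0]|[x [v xv0] xA]].
  exists (fun v => y 0 (enum_rank v)) => [|v].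
    by have /rV0Pn[j yj] := y0; exists (enum_val j); rewrite enum_valK.
  move/rowP/(_ (enum_rank v)): yA; rewrite !mxE => <-; rewrite adj_sum.
  by apply: eq_bigr => j _; rewrite enum_valK.
exists (\row_j x (enum_val j)).
  apply/rowP => j; rewrite !mxE -xA adj_sum; apply: eq_bigr => i _.
  by rewrite mxE enum_valK.
by apply/rV0Pn; exists (enum_rank v); rewrite mxE enum_rankK.
Qed.

Lemma not_three_eigenvalues (F : fieldType) m (A : 'M[F]_m) (t : seq F) :
  uniq t -> (3 < size t)%N -> {in t, forall a, eigenvalue A a} ->
  ~ has_distinct_eigenvalues A 3.
Proof.
move=> t_uniq t_gt3 tA [s [_ s3 sA]].
suff: (size t <= size s)%N by rewrite s3 leqNgt t_gt3.
by apply: uniq_leq_size => // a /tA; rewrite sA.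
Qed.

(** * Spectra of regular graphs *)

Definition regular_of_degree (G : sgraph) (k : nat) :=
  forall u : G, #|[set v | adj u v]| = k.

Section Regular.
Variables (G : sgraph) (k : nat).
Hypothesis Gk : regular_of_degree G k.

Lemma regular_sum_const (F : nzRingType) (v : G) :
  \sum_(u | adj v u) (1 : F) = k%:R.
Proof. by rewrite sumr_const -(Gk v) cardsE. Qed.

Lemma regular_eigenvalue (F : fieldType) (v0 : G) :
  eigenvalue (adjacency_mx F G) k%:R.
Proof.
apply/eigenvalue_adjacencyP; exists (fun=> 1) => [|v].
  by exists v0; rewrite oner_eq0.
by rewrite regular_sum_const mulr1.
Qed.

(* Compare the l1-norms of both sides of [A x = a x]. *)
Lemma regular_eigenvalue_norm (C : numClosedFieldType) (a : C) :
  eigenvalue (adjacency_mx C G) a -> `|a| <= k%:R.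
Proof.
case/eigenvalue_adjacencyP => x [v xv0] xA.
have x_gt0 : 0 < \sum_u `|x u|.
  rewrite (bigD1 v) //= ltr_wpDr ?normr_gt0 //.
  by apply: sumr_ge0 => u _; exact: normr_ge0.
rewrite -(ler_pM2r x_gt0) !mulr_sumr.
under eq_bigr do rewrite -normrM -xA.
apply: le_trans (ler_sum _ (fun v _ => ler_norm_sum _ _ _)) _.
(* With the sums exchanged, [|x u|] is counted once per neighbour of [u], that is, [k] times. *)
rewrite (exchange_big_dep predT) //=; apply: ler_sum => u _.
under eq_bigl do rewrite adj_sym.
under eq_bigr do rewrite -[`|_|]mul1r.
by rewrite -mulr_suml regular_sum_const.
Qed.

(* Otherwise [A ^ 2 = k ^ 2], whereas the diagonal of [A ^ 2] is [k]. *)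
Lemma regular_other_eigenvalue (C : numClosedFieldType) (v0 : G) :
  (1 < k)%N ->
  exists a : C, [/\ eigenvalue (adjacency_mx C G) a, a != k%:R & a != - k%:R].
Proof.
move=> k_gt1; set A := adjacency_mx C G.
have AT i j : A i j = A j i by rewrite !mxE adj_sym.
(* A real symmetric matrix is normal, so the spectral theorem gives [A = P^-1 diag(d) P]; the rows
   of [P] are then eigenvectors. *)
have A_normal : A \is normalmx.
  apply/hermitian_normalmx/realsym_hermsym; last first.
    by apply/mxOverP => i j; rewrite mxE realn.
  apply/is_hermitianmxP; rewrite expr0 scale1r.
  by apply/matrixP => i j; rewrite !mxE adj_sym.
have P_unit := spectral_unit A.
have /orthomx_spectralP := A_normal.
set P := spectralmx A in P_unit *; set d := spectral_diag A => A_eq.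
have d_eig i : eigenvalue A (d 0 i).
  apply/eigenvalueP; exists (row i P).
    rewrite -row_mul {1}A_eq !mulmxA mulmxV // mul1mx.
    by rewrite row_mul row_diag_mx -scalemxAl -rowE.
  apply/eqP => Pi0; have := row_mul i P (invmx P).
  rewrite mulmxV // Pi0 mul0mx => /rowP/(_ i)/eqP.
  by rewrite !mxE eqxx oner_eq0.
case: (boolP [exists i, (d 0 i != k%:R) && (d 0 i != - k%:R)]) => [|noeig].
  by case/existsP => i /andP[dk dNk]; exists (d 0 i).
have d2 i : d 0 i * d 0 i = k%:R ^+ 2.
  move: noeig; rewrite negb_exists => /forallP/(_ i).
  by rewrite negb_and !negbK => /orP[]/eqP->; rewrite ?mulrNN expr2.
have A2 : A *m A = (k%:R ^+ 2)%:M.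
  rewrite {1 2}A_eq -!mulmxA (mulmxA P) mulmxV // mul1mx (mulmxA (diag_mx d)).
  rewrite mulmx_diag; have -> : \row_j (d 0 j * d 0 j) = const_mx (k%:R ^+ 2).
    by apply/rowP => j; rewrite !mxE d2.
  by rewrite diag_const_mx mul_scalar_mx -scalemxAr mulVmx // scalemx1.
have /matrixP/(_ (enum_rank v0) (enum_rank v0)) := A2.
rewrite !mxE eqxx mulr1n -(regular_sum_const C v0) => /eqP.
suff -> : \sum_j A (enum_rank v0) j * A j (enum_rank v0) = k%:R.
  by rewrite regular_sum_const -natrX eqr_nat; nia.
rewrite -(regular_sum_const C v0) [RHS]big_mkcond /=.
rewrite (reindex (@enum_rank G)); last first.
  by apply: onW_bij; exact: enum_rank_bij.
apply: eq_bigr => u _; rewrite AT !mxE !enum_rankK adj_sym.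
by case: adj; rewrite ?mulr1 ?mulr0.
Qed.

End Regular.

(** * Incidence maps and the spectrum of a line graph *)

Lemma adj_neq (G : sgraph) (x y : G) : adj x y -> x != y.
Proof. by apply: contraTneq => ->; rewrite adj_irrefl. Qed.

Section LineSpectrum.
Variables (G : sgraph) (F : fieldType).

Lemma mem_edges (x y : G) : adj x y -> [set x; y] \in edges G.
Proof.
by move=> xy; rewrite inE; apply/existsP; exists x; apply/existsP; exists y;
  rewrite xy eqxx.
Qed.

Definition mk_edge (x y : G) (xy : adj x y) : line_graph G :=
  Sub [set x; y] (mem_edges xy).

Lemma edgeP (e : edge G) : exists x y, adj x y /\ val e = [set x; y].
Proof.
have := valP e; rewrite inE => /existsP[x /existsP[y /andP[xy /eqP e_xy]]].
by exists x, y.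
Qed.

Lemma card_edge (e : edge G) : #|val e| = 2%N.
Proof. by have [x [y [xy ->]]] := edgeP e; rewrite cards2 (adj_neq xy). Qed.

(** These are the entries of [N N^T = 2 + A(L(G))]: edges that share both ends are equal. *)
Lemma card_edgeI (e f : edge G) :
  #|val e :&: val f| = ((e == f) * 2 + @adj (line_graph G) e f)%N.
Proof.
rewrite /= /line_adj; case: eqVneq => [->|ef]; first by rewrite setIid card_edge.
rewrite add0n -card_gt0 /=.
suff: (#|val e :&: val f| < 2)%N by case: #|_| => [|[|]].
rewrite ltnNge; apply: contra ef => le2; apply/eqP/val_inj.
have /eqP <- : val e :&: val f == val e.
  by rewrite eqEcard subsetIl card_edge.
by apply/eqP; rewrite eqEcard subsetIr card_edge.
Qed.

(** Multiplication by the edge-by-vertex incidence matrix [N]; [coincidence] is multiplication by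
    its transpose. *)
Definition incidence (x : G -> F) (e : line_graph G) : F :=
  \sum_(v in val e) x v.

Definition coincidence (y : line_graph G -> F) (v : G) : F :=
  \sum_(e : line_graph G | v \in val e) y e.

Lemma edges_at (v : G) :
  [set s in edges G | v \in s] = (fun u => [set v; u]) @: [set u | adj v u].
Proof.
apply/setP => s; rewrite !inE; apply/andP/imsetP => [[]|[u]].
  move=> /existsP[x /existsP[y /andP[xy /eqP->]]].
  rewrite !inE => /orP[]/eqP->; first by exists y; rewrite ?inE.
  by exists x; rewrite ?inE 1?adj_sym // setUC.
rewrite inE => vu ->; rewrite !inE eqxx; split=> //.
by apply/existsP; exists v; apply/existsP; exists u; rewrite vu eqxx.
Qed.

(** This is [N^T N = D + A(G)] with [D] the diagonal matrix of degrees: the edges at [v] correspond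
    to the neighbours of [v]. *)
Lemma coincidence_incidence (x : G -> F) v :
  coincidence (incidence x) v = \sum_(u | adj v u) (x v + x u).
Proof.
pose Y (s : {set G}) := \sum_(u in s) x u.
transitivity (\sum_(s in [set s in edges G | v \in s]) Y s).
  rewrite /coincidence [RHS](eq_bigl (fun s => (s \in edges G) && (v \in s)));
    last by move=> s; rewrite inE.
  exact/esym/(big_sub_cond (edges G) (fun s => v \in s) Y).
rewrite edges_at big_imset /=; last first.
  move=> u u'; rewrite !inE => vu vu' /setP/(_ u).
  by rewrite !inE eqxx orbT eq_sym (negPf (adj_neq vu)) => /esym/eqP.
apply: eq_big => [u|u vu]; rewrite ?inE //.
rewrite /Y big_setU1 ?big_set1 // inE; move: vu; rewrite inE; exact: adj_neq.
Qed.

Lemma incidence_coincidence (y : line_graph G -> F) e :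
  incidence (coincidence y) e = y e *+ 2 + \sum_(f | adj e f) y f.
Proof.
rewrite /incidence /coincidence (exchange_big_dep predT) //=.
transitivity (\sum_f (y f *+ 2 *+ (f == e) + y f *+ adj e f)).
  apply: eq_bigr => f _; rewrite sumr_const -!mulrnA -mulrnDr.
  congr (_ *+ _); rewrite eq_sym mulnC -card_edgeI -cardsE.
  by apply: eq_card => v; rewrite !inE.
rewrite big_split /=; congr (_ + _); last first.
  by rewrite [RHS]big_mkcond; apply: eq_bigr => f _; rewrite mulrb.
rewrite -(big_pred1_eq +%R e (fun f => y f *+ 2)) big_mkcond /=.
by apply: eq_bigr => f _; rewrite mulrb.
Qed.

(** From [N^T N x = (a + k) x] follows [N N^T (N x) = (a + k) (N x)], and [N x] is nonzero because
    [N^T] maps it to [(a + k) x]. *)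
Lemma line_eigenvalue_lift k (a : F) :
  regular_of_degree G k -> eigenvalue (adjacency_mx F G) a ->
  a + k%:R != 0 ->
  eigenvalue (adjacency_mx F (line_graph G)) (a + k%:R - 2).
Proof.
move=> Gk /eigenvalue_adjacencyP[x [v xv0] xA] ak0.
have NTN u : coincidence (incidence x) u = (a + k%:R) * x u.
  rewrite coincidence_incidence big_split /= xA.
  under eq_bigr do rewrite -[x u]mul1r.
  by rewrite -mulr_suml (regular_sum_const Gk) -mulrDl addrC.
apply/eigenvalue_adjacencyP; exists (incidence x) => [|e].
  apply/existsP; rewrite -negb_forall; apply/negP => /forallP Nx0.
  have /eqP := NTN v; rewrite eq_sym /coincidence big1 => [|e _].
    by rewrite mulf_eq0 (negPf ak0) (negPf xv0).
  exact/eqP/Nx0.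
have := incidence_coincidence (incidence x) e.
rewrite {1}/incidence (eq_bigr _ (fun u _ => NTN u)) -mulr_sumr.
rewrite -/(incidence x e) => /esym/(canRL (addKr _)) ->.
by rewrite mulrBl [2 * _]mulr_natl addrC.
Qed.

Lemma line_eigenvalue_ker (y : line_graph G -> F) :
  (exists e, y e != 0) -> (forall v, coincidence y v = 0) ->
  eigenvalue (adjacency_mx F (line_graph G)) (- 2).
Proof.
move=> y0 NTy0; apply/eigenvalue_adjacencyP; exists y => // e.
have := incidence_coincidence y e.
rewrite /incidence big1 // => /esym/eqP; rewrite addrC addr_eq0 => /eqP->.
by rewrite mulNr mulr_natl.
Qed.

End LineSpectrum.

(** Evaluate [N N^T = 2 + A(L(G))] at the constant edge weighting [N 1 = 2]: since [N^T N 1 = 2 k],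
    the degree [d] of [e] satisfies [4 k = 4 + 2 d]. *)
Lemma line_regular (G : sgraph) k :
  regular_of_degree G k -> regular_of_degree (line_graph G) (k.*2 - 2).
Proof.
move=> Gk e; pose one (v : G) : rat := 1.
have N1 f : incidence one f = 2 by rewrite /incidence sumr_const card_edge.
have NTN v : coincidence (incidence one) v = 2 *+ k.
  by rewrite coincidence_incidence sumr_const -(Gk v) cardsE.
have := incidence_coincidence (incidence one) e.
rewrite {1}/incidence (eq_bigr _ (fun v _ => NTN v)) sumr_const card_edge N1.
rewrite (eq_bigr _ (fun f _ => N1 f)) sumr_const -cardsE.
set d := #|_|; rewrite -!mulrnA -!mulrnDr => /eqP.
by rewrite eqr_nat => /eqP kd; lia.
Qed.

(** * Cycles, their line graphs and their eigenvalues *)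

Lemma eq_set2 (T : finType) (a b c d : T) :
  ([set a; b] == [set c; d]) =
  ((a == c) && (b == d)) || ((a == d) && (b == c)).
Proof.
apply/eqP/orP => [/setP E|[]/andP[/eqP-> /eqP->] //]; last exact: setUC.
have := E a; have := E b; have := E c; have := E d; rewrite !inE !eqxx ?orbT.
rewrite (eq_sym c a) (eq_sym c b) (eq_sym d a) (eq_sym d b) => {E}.
by case: (a == c) (a == d) (b == c) (b == d) => [] [] [] [] //= *; auto.
Qed.

Lemma setI2_neq0 (T : finType) (a b c d : T) :
  ([set a; b] :&: [set c; d] != set0) = [|| a == c, a == d, b == c | b == d].
Proof.
rewrite -[RHS]negbK; congr (~~ _); rewrite setI_eq0 disjoints_subset.
by rewrite subUset !sub1set !inE !negb_or -!andbA.
Qed.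

Section Cycles.
Variables (m : nat) (m_gt2 : (2 < m)%N).

(** An [m]-periodic sequence on all of [nat] stands for a cycle, so that successors need no
    wrap-around. Chords are allowed. *)
Definition cycle_in (G : sgraph) (w : nat -> G) :=
  (forall i, adj (w i) (w i.+1)) /\
  (forall i j, (w i == w j) = (i == j %[mod m])).

(** Here the whole graph is the cycle: no further vertices and no chords. *)
Definition is_cycle (G : sgraph) (w : nat -> G) :=
  [/\ cycle_in w, forall v, exists i, v = w i &
      forall i j, adj (w i) (w j) = (i.+1 == j %[mod m]) || (j.+1 == i %[mod m])].

Lemma neq_modS i : (i.+1 == i %[mod m]) = false.
Proof. by rewrite -addn1 -{2}[i]addn0 eqn_modDl !modn_small //; lia. Qed.

Lemma neq_modSS i : (i.+2 == i %[mod m]) = false.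
Proof. by rewrite -addn2 -{2}[i]addn0 eqn_modDl !modn_small //; lia. Qed.

Lemma eq_modS i j : (i.+1 == j.+1 %[mod m]) = (i == j %[mod m]).
Proof. by rewrite -(addn1 i) -(addn1 j) eqn_modDr. Qed.

Lemma periodic_modn (T : Type) (g : nat -> T) :
  (forall i, g (i + m)%N = g i) -> forall i, g (i %% m)%N = g i.
Proof.
move=> g_m i; rewrite {2}(divn_eq i m).
by elim: (i %/ m)%N => [|q IHq] //; rewrite mulSn -addnA addnC g_m.
Qed.

Section LineCycle.
Variables (G : sgraph) (w : nat -> G).

Definition line_walk (wC : cycle_in w) (i : nat) : line_graph G :=
  mk_edge (wC.1 i).

(** Two edges of the cycle could also coincide with their ends swapped, but then [j + 2] and [j]
    would agree modulo [m], against [m > 2]. *)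
Lemma line_walk_cycle_in (wC : cycle_in w) : cycle_in (line_walk wC).
Proof.
have w_eq := wC.2.
have lw_eq i j : (line_walk wC i == line_walk wC j) = (i == j %[mod m]).
  rewrite -val_eqE /= eq_set2 !w_eq eq_modS andbb.
  case: (i == j %[mod m]) => //=; apply/negbTE/negP => /andP[ij ji].
  have := neq_modSS j; rewrite -(eqP ji).
  by rewrite eq_sym eq_modS ij.
split=> // i; rewrite /= /line_adj.
have -> : line_walk wC i != line_walk wC i.+1 by rewrite lw_eq eq_sym neq_modS.
by rewrite /= setI2_neq0 eqxx !orbT.
Qed.

Lemma line_is_cycle :
  is_cycle w -> exists w' : nat -> line_graph G, is_cycle w'.
Proof.
move=> [wC w_surj w_adj]; have w_eq := wC.2.
exists (line_walk wC); have lwC := line_walk_cycle_in wC.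
split=> // [e|i j].
  have [x [y [xy e_xy]]] := edgeP e.
  have [i x_i] := w_surj x; have [j y_j] := w_surj y.
  move: xy; rewrite x_i y_j w_adj -!w_eq => /orP[] /eqP wij.
    by exists i; apply: val_inj; rewrite e_xy /= wij x_i y_j.
  by exists j; apply: val_inj; rewrite e_xy /= wij x_i y_j setUC.
rewrite /= {1}/line_adj lwC.2 /= setI2_neq0 !w_eq eq_modS.
case: (boolP (i == j %[mod m])) => [/eqP ij|_] /=; last first.
  by rewrite orbF orbC; congr (_ || _); rewrite eq_sym.
by rewrite -ij -[j.+1]addn1 -modnDml -ij modnDml addn1 !neq_modS.
Qed.

(* The alternating sum of the edges of an even cycle has zero sum at each
   vertex. *)
Lemma even_cycle_line_eigenvalue (F : fieldType) :
  cycle_in w -> ~~ odd m ->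
  eigenvalue (adjacency_mx F (line_graph G)) (- 2).
Proof.
move=> wC m_even; have w_eq := wC.2; have lw_eq := (line_walk_cycle_in wC).2.
pose y (e : line_graph G) : F :=
  \sum_(i < m) (-1) ^+ i * (e == line_walk wC i)%:R.
apply: (@line_eigenvalue_ker G F y).
  exists (line_walk wC 0); rewrite /y (bigD1 (Ordinal (ltnW (ltnW m_gt2)))) //=.
  rewrite eqxx mulr1 big1 ?addr0 ?oner_eq0 // => i.
  rewrite -val_eqE /= => i0; rewrite lw_eq !modn_small ?ltn_ord //; last by lia.
  by rewrite eq_sym (negPf i0) mulr0.
move=> v; rewrite /coincidence /y exchange_big /=.
(* The sum at [v] telescopes to [t 0 - t m], which vanishes because [m] is even and [w m = w 0]. *)
pose t i : F := (-1) ^+ i * (v == w i)%:R.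
transitivity (\sum_(0 <= i < m) (t i - t i.+1)).
  rewrite big_mkord; apply: eq_bigr => i _; rewrite -mulr_sumr /t exprS.
  rewrite mulN1r mulNr opprK -mulrDr; congr (_ * _).
  transitivity ((v \in val (line_walk wC i))%:R : F).
    rewrite big_mkcond (bigD1 (line_walk wC i)) //= big1 => [|e /negPf ->].
      by rewrite eqxx addr0; case: (v \in _).
    by case: ifP.
  rewrite /= !inE; case: (eqVneq v (w i)) => [->|] /=; last by rewrite add0r.
  by rewrite (negPf (adj_neq (wC.1 i))) addr0.
rewrite (@telescope_sumr_eq _ _ _ (fun i => - t i)) //; last first.
  by move=> i _; rewrite opprK addrC.
rewrite /t -signr_odd (negPf m_even) (_ : w m = w 0%N) ?subrr //.
by apply/eqP; rewrite w_eq modnn mod0n.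
Qed.

End LineCycle.

Section CycleSpectrum.
Variables (G : sgraph) (w : nat -> G).
Hypothesis wC : is_cycle w.

(** Centring at [i.+1] avoids predecessors; [is_cycle_surjS] provides such an index for every
    vertex. *)
Lemma is_cycle_adj i v : adj (w i.+1) v = (v \in [set w i; w i.+2]).
Proof.
case: wC => [[_ w_eq] w_surj w_adj]; have [j ->] := w_surj v.
by rewrite w_adj !inE !w_eq eq_modS orbC; congr (_ || _); rewrite eq_sym.
Qed.

Lemma is_cycle_surjS v : exists i, v = w i.+1.
Proof.
case: wC => [[_ w_eq] w_surj _]; have [j ->] := w_surj v.
exists (j + m).-1; apply/eqP; rewrite w_eq prednK ?modnDr //; lia.
Qed.

Lemma is_cycle_neq i : w i != w i.+2.
Proof. by case: wC => [[_ w_eq] _ _]; rewrite w_eq eq_sym neq_modSS. Qed.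

Lemma is_cycle_connected : connected G.
Proof.
case: wC => [[w_edge _] w_surj _]; split; first by apply/card_gt0P; exists (w 0).
have w0 i : connect (@adj G) (w 0) (w i).
  elim: i => // i IHi; exact: connect_trans IHi (connect1 (w_edge i)).
move=> u v; have [i ->] := w_surj u; have [j ->] := w_surj v.
by apply: connect_trans (w0 j); rewrite (sym_connect_sym (@adj_sym G)).
Qed.

Lemma is_cycle_regular : regular_of_degree G 2.
Proof.
move=> u; have [i ->] := is_cycle_surjS u.
rewrite (_ : [set v | _] = [set w i; w i.+2]) ?cards2 ?is_cycle_neq //.
by apply/setP => v; rewrite inE is_cycle_adj.
Qed.

(** Read along the cycle, an eigenvector is an [m]-periodic solution of a three-term recurrence. *)
Lemma is_cycle_eigenvalueP (F : fieldType) (a : F) :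
  eigenvalue (adjacency_mx F G) a <->
  exists g : nat -> F, [/\ forall i, g (i + m)%N = g i, exists i, g i != 0 &
                          forall i, g i + g i.+2 = a * g i.+1].
Proof.
have w_sum (x : G -> F) i :
    \sum_(u | adj (w i.+1) u) x u = x (w i) + x (w i.+2).
  rewrite (eq_bigl _ _ (is_cycle_adj i)) big_setU1 ?big_set1 // inE.
  exact: is_cycle_neq.
case: (wC) => [[_ w_eq] w_surj _].
split=> [/eigenvalue_adjacencyP[x [v xv0] xA]|[g [g_m [i gi0] gA]]].
  exists (x \o w); split=> [i||i] /=; last by rewrite -xA w_sum.
    by congr x; apply/eqP; rewrite w_eq modnDr.
  by have [i vi] := w_surj v; exists i; rewrite -vi.
have w_idx v : exists i, v == w i by have [j ->] := w_surj v; exists j.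
have g_mod := periodic_modn g_m.
(* The choice of an index for [v] is harmless, as [g] is [m]-periodic. *)
pose x v := g (xchoose (w_idx v)).
have xw j : x (w j) = g j.
  by have /eqP := xchooseP (w_idx (w j)); move/eqP; rewrite w_eq -g_mod => /eqP->.
apply/eigenvalue_adjacencyP; exists x => [|v]; first by exists (w i); rewrite xw.
by have [j ->] := is_cycle_surjS v; rewrite w_sum !xw gA.
Qed.

(** One period of an eigenvector, given as a list, certifies an eigenvalue by finitely many
    checks. *)
Lemma is_cycle_eigenvalue_seq (F : fieldType) (a : F) (c : seq F) :
  (exists2 i, (i < m)%N & c`_i != 0) ->
  (forall i, (i < m)%N -> c`_i + c`_((i + 2) %% m) = a * c`_((i + 1) %% m)) ->
  eigenvalue (adjacency_mx F G) a.
Proof.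
move=> [i i_lt ci0] c_eq; apply/is_cycle_eigenvalueP.
exists (fun i => c`_(i %% m)); split=> [j||j]; first by rewrite modnDr.
  by exists i; rewrite modn_small.
rewrite -[j.+2]addn2 -[j.+1]addn1 -(modnDml j 1) -(modnDml j 2).
by rewrite c_eq // ltn_pmod; lia.
Qed.

End CycleSpectrum.
End Cycles.

(** * The cycles of length 3, 4 and 6 *)

Lemma cycle3_not_three_eigenvalues (F : numFieldType) (G : sgraph)
    (w : nat -> G) :
  is_cycle 3 w -> ~ has_distinct_eigenvalues (adjacency_mx F G) 3.
Proof.
move=> wC [s [s_uniq s3 sA]].
have s_sub : {subset s <= [:: 2; - 1]}.
  move=> a; rewrite -sA => /(@is_cycle_eigenvalueP 3 isT _ _ wC)[g [g_m [i gi0] gA]].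
  rewrite !inE -[_ || _]negbK; apply/negP; rewrite negb_or => /andP[a2 aN1].
  have g3 : g 3%N = g 0%N by rewrite -(g_m 0%N).
  have g4 : g 4%N = g 1%N by rewrite -(g_m 1%N).
  have := gA 0%N; have := gA 1%N; have := gA 2%N; rewrite g3 g4 => e2 e1 e0.
  (* Adding the three equations shows that the entries sum to zero when [a] is not 2; each equation
     then reads [(a + 1) g_j = 0]. *)
  have sum_g : (a - 2) * (g 0%N + g 1%N + g 2%N) = 0.
    by rewrite mulrBl !mulrDr -e0 -e1 -e2; ring.
  move/eqP: sum_g; rewrite mulf_eq0 subr_eq0 (negPf a2) /= => /eqP sum_g.
  have g0 j : (a + 1) * g j = 0 -> g j = 0.
    by move/eqP; rewrite mulf_eq0 addr_eq0 (negPf aN1) /= => /eqP.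
  have g_0 : g 0%N = 0.
    by apply: g0; rewrite mulrDl mul1r -e2 -[RHS]sum_g; ring.
  have g_1 : g 1%N = 0.
    by apply: g0; rewrite mulrDl mul1r -e0 -[RHS]sum_g; ring.
  have g_2 : g 2%N = 0.
    by apply: g0; rewrite mulrDl mul1r -e1 -[RHS]sum_g; ring.
  move/eqP: gi0; apply; rewrite -(periodic_modn g_m).
  have := ltn_pmod i (isT : (0 < 3)%N).
  by case: (i %% 3)%N => [|[|[|]]].
by have := uniq_leq_size s_uniq s_sub; rewrite s3.
Qed.

Lemma cycle4_strongly_regular (F : numFieldType) (G : sgraph) (w : nat -> G) :
  is_cycle 4 w -> strongly_regular F G.
Proof.
move=> wC; split.
- exact: is_cycle_connected wC.
- by exists 2%N; exact: is_cycle_regular wC.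
exists [:: 2; 0; - 2]; split=> //.
  rewrite /= !inE !negb_or pnatr_eq0 [0 == _]eq_sym oppr_eq0 pnatr_eq0 /= andbT.
  by rewrite -subr_eq0 opprK -natrD pnatr_eq0.
move=> a; apply/idP/idP => [|].
  move=> /(@is_cycle_eigenvalueP 4 isT _ _ wC)[g [g_m [i gi0] gA]].
  rewrite !inE -[X in is_true X]negbK; apply/negP; rewrite !negb_or.
  case/and3P=> a2 a0 aN2.
  have double0 (z : F) : z + z = 0 -> z = 0.
    by move/eqP; rewrite -mulr2n mulrn_eq0 => /eqP.
  have g4 : g 4%N = g 0%N by rewrite -(g_m 0%N).
  have g5 : g 5%N = g 1%N by rewrite -(g_m 1%N).
  have := gA 0%N; have := gA 1%N; have := gA 2%N; have := gA 3%N.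
  rewrite g4 g5 => e3 e2 e1 e0.
  (* The plain and the alternating sum of the equations isolate the eigenvalues 2 and -2. Otherwise
     both sums vanish, so opposite entries cancel and each equation becomes [a g_j = 0]. *)
  have p0 : (a - 2) * (g 0%N + g 2%N + g 1%N + g 3%N) = 0.
    by rewrite mulrBl !mulrDr -e0 -e1 -e2 -e3; ring.
  have q0 : (a + 2) * (g 0%N + g 2%N - g 1%N - g 3%N) = 0.
    by rewrite mulrDl !mulrBr mulrDr -e0 -e1 -e2 -e3; ring.
  move/eqP: p0; rewrite mulf_eq0 subr_eq0 (negPf a2) /= => /eqP p0.
  move/eqP: q0; rewrite mulf_eq0 addr_eq0 (negPf aN2) /= => /eqP q0.
  have g02 : g 0%N + g 2%N = 0.
    apply: double0; rewrite -[RHS]addr0 -{1}p0 -q0; ring.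
  have g13 : g 1%N + g 3%N = 0 by rewrite -[RHS]p0 -addrA g02 add0r.
  have g0 j : a * g j = 0 -> g j = 0.
    by move/eqP; rewrite mulf_eq0 (negPf a0) /= => /eqP.
  have g_0 : g 0%N = 0 by apply: g0; rewrite -e3 ?[g 2%N + _]addrC ?[g 3%N + _]addrC.
  have g_1 : g 1%N = 0 by apply: g0; rewrite -e0 ?[g 2%N + _]addrC ?[g 3%N + _]addrC.
  have g_2 : g 2%N = 0 by apply: g0; rewrite -e1 ?[g 2%N + _]addrC ?[g 3%N + _]addrC.
  have g_3 : g 3%N = 0 by apply: g0; rewrite -e2 ?[g 2%N + _]addrC ?[g 3%N + _]addrC.
  move/eqP: gi0; apply; rewrite -(periodic_modn g_m).
  have := ltn_pmod i (isT : (0 < 4)%N).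
  by case: (i %% 4)%N => [|[|[|[|]]]].
have eig := @is_cycle_eigenvalue_seq 4 isT _ _ wC F.
rewrite !inE => /or3P[] /eqP->;
  [apply: (eig _ [:: 1; 1; 1; 1]) | apply: (eig _ [:: 1; 1; - 1; - 1])
  | apply: (eig _ [:: 1; - 1; 1; - 1])];
  try (by exists 0%N; rewrite //= oner_eq0);
  by case=> [|[|[|[|]]]] //= _; ring.
Qed.

Lemma cycle6_not_three_eigenvalues (F : numFieldType) (G : sgraph)
    (w : nat -> G) :
  is_cycle 6 w -> ~ has_distinct_eigenvalues (adjacency_mx F G) 3.
Proof.
move=> wC; have eig := @is_cycle_eigenvalue_seq 6 isT _ _ wC F.
(* These are the numbers [2 cos (pi j / 3)] for [j] from 0 to 3; they are distinct because the
   integers embed in [F]. *)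
apply: (@not_three_eigenvalues _ _ _ [:: 2; 1; - 1; - 2]) => //.
  have inj : injective (fun z : int => z%:~R : F) by exact: intr_inj.
  by rewrite -[X in uniq X]/(map (fun z : int => z%:~R : F) [:: 2; 1; - 1; - 2]) map_inj_uniq.
move=> a; rewrite !inE => /or4P[] /eqP->;
  [apply: (eig _ [:: 1; 1; 1; 1; 1; 1])
  | apply: (eig _ [:: 1; 1; 0; - 1; - 1; 0])
  | apply: (eig _ [:: 1; - 1; 0; 1; - 1; 0])
  | apply: (eig _ [:: 1; - 1; 1; - 1; 1; - 1])];
  try (by exists 0%N; rewrite //= oner_eq0);
  by case=> [|[|[|[|[|[|]]]]]] //= _; ring.
Qed.

(** * The size of a line graph and four eigenvalues of [L^2(G)] *)

Lemma card_line_graph (G : sgraph) : (#|line_graph G| <= 'C(#|G|, 2))%N.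
Proof.
rewrite card_sig -card_draws.
apply: subset_leq_card; apply/subsetP => e; rewrite !inE.
move=> /existsP[x /existsP[y /andP[xy /eqP->]]].
by rewrite cards2 (adj_neq xy).
Qed.

Section FourEigenvalues.
Variables (C : numClosedFieldType) (G : sgraph) (k m : nat) (w : nat -> G).
Hypotheses (Gk : regular_of_degree G k) (k_gt2 : (2 < k)%N).
Hypotheses (wC : cycle_in m w) (m_gt2 : (2 < m)%N) (m_even : ~~ odd m).

Lemma line2_not_three_eigenvalues :
  ~ has_distinct_eigenvalues (adjacency_mx C (line_graph (line_graph G))) 3.
Proof.
have L1k := line_regular Gk; have L2k := line_regular L1k.
have w1C := line_walk_cycle_in m_gt2 wC.
have [a [a_eig a_neqk a_neqNk]] := regular_other_eigenvalue Gk C (w 0%N) (ltnW k_gt2).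
have ak0 : a + k%:R != 0 by rewrite addr_eq0.
have a_norm := regular_eigenvalue_norm Gk a_eig.
have kE : (k.*2 - 2)%:R = k%:R * 2 - 2 :> C.
  by rewrite -muln2 natrB ?natrM //; lia.
have kkE : ((k.*2 - 2).*2 - 2)%:R = k%:R * 4 - 6 :> C.
  by rewrite (_ : (_ - _)%N = (k * 4 - 6)%N) ?natrB ?natrM //; lia.
(* Otherwise [|a| = 3 k - 4], which exceeds [k] as [k > 2]. This serves both to lift [a + k - 2] to
   [L^2(G)] and to separate [a + 3 k - 6] from -2. *)
have a_low : a + k%:R * 3 - 4 != 0.
  apply: contraTneq a_norm => a_eq.
  have -> : a = - (k * 3 - 4)%:R.
    rewrite natrB ?natrM; last by lia.
    by apply/eqP; rewrite -subr_eq0 -[X in _ == X]a_eq; apply/eqP; ring.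
  by rewrite normrN normr_nat ler_nat -ltnNge; lia.
pose t := [:: k%:R * 4 - 6; a + k%:R * 3 - 6; k%:R * 2 - 6; - 2] : seq C.
apply: (@not_three_eigenvalues _ _ _ t) => //.
  rewrite /= !inE !negb_or andbT -!andbA.
  have neqP (x y z : C) : z != 0 -> x - y = z -> x != y.
    by move=> z0 xyz; rewrite -subr_eq0 xyz.
  have k2 : (k - 2)%:R != 0 :> C by rewrite pnatr_eq0; lia.
  have k1 : (k - 1)%:R != 0 :> C by rewrite pnatr_eq0; lia.
  have k0 : k%:R != 0 :> C by rewrite pnatr_eq0; lia.
  have n2 : 2 != 0 :> C by rewrite pnatr_eq0.
  apply/and5P; split.
  - by apply: (neqP _ _ (k%:R - a)); [rewrite subr_eq0 eq_sym|ring].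
  - by apply: (neqP _ _ (2 * k%:R)); [rewrite mulf_neq0|ring].
  - apply: (neqP _ _ (2 * 2 * (k - 1)%:R)); first by rewrite !mulf_neq0.
    by rewrite natrB; [ring|lia].
  - by apply: (neqP _ _ (a + k%:R)); [|ring].
  apply/andP; split.
    by apply: (neqP _ _ (a + k%:R * 3 - 4)); [|ring].
  apply: (neqP _ _ (2 * (k - 2)%:R)); first by rewrite !mulf_neq0.
  by rewrite natrB; [ring|lia].
move=> b; rewrite !inE => /or4P[] /eqP->.
- rewrite -kkE; exact: (regular_eigenvalue L2k C (line_walk w1C 0)).
- have := line_eigenvalue_lift L1k (line_eigenvalue_lift Gk a_eig ak0).
  rewrite kE (_ : a + k%:R - 2 + _ = a + k%:R * 3 - 4); last by ring.
  by move/(_ a_low); congr (eigenvalue _ _); ring.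
(* The eigenvalue -2 of [L(G)] lifts because [-2 + (2 k - 2) = 2 (k - 2)] is nonzero. *)
- have := line_eigenvalue_lift L1k (even_cycle_line_eigenvalue m_gt2 C wC m_even).
  rewrite kE (_ : - 2 + _ = 2 * (k - 2)%:R); last by rewrite natrB; [ring|lia].
  rewrite mulf_neq0 ?pnatr_eq0; last by lia.
    by move=> /(_ isT); congr (eigenvalue _ _); rewrite natrB; [ring|lia].
  by [].
(* The edges of the cycle in [G] form a cycle of the same even length in [L(G)]. *)
exact: (even_cycle_line_eigenvalue m_gt2 C w1C m_even).
Qed.

End FourEigenvalues.

(** * Unitary Cayley graphs *)

Lemma coprime_subl i n : (i <= n)%N -> coprime (n - i) n = coprime i n.
Proof.
move=> /subnK; move: (n - i)%N => d <-.
by rewrite /coprime gcdnDl addnC gcdnDl gcdnC.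
Qed.

Section UnitaryCayleyGraph.
Variables (n : nat) (n_gt1 : (1 < n)%N).

Lemma unitary_cayley_adjE (i j : unitary_cayley n) :
  adj i j = coprime (`|i%:Z - j%:Z|%N) n.
Proof.
rewrite /= /unitary_cayley_adj /gcdz absz_nat eqz_nat -/(coprime _ _).
case: eqVneq => //= ->; rewrite subrr absz0 /coprime gcd0n.
by case: eqVneq n_gt1 => // ->.
Qed.

Lemma unitary_cayley_adj_le (i j : unitary_cayley n) :
  (i <= j)%N -> adj i j = coprime (j - i) n.
Proof.
by move=> le_ij; rewrite unitary_cayley_adjE; congr (coprime _ _); lia.
Qed.

End UnitaryCayleyGraph.

(** Translation by [i] carries the neighbours of 0 onto those of [i]. *)
Lemma unitary_cayley_regular n :
  (1 < n)%N -> exists k, regular_of_degree (unitary_cayley n) k.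
Proof.
case: n => [|n] // n_gt1.
have shift (i j : 'I_n.+1) :
    unitary_cayley_adj i (i + j) = unitary_cayley_adj 0 j.
  have := unitary_cayley_adjE n_gt1 (0 : 'I_n.+1) j; rewrite [LHS]/= => ->.
  have := unitary_cayley_adjE n_gt1 i (i + j); rewrite [LHS]/= => ->.
  have -> : nat_of_ord (i + j) = ((i + j) %% n.+1)%N by [].
  rewrite sub0r abszN absz_nat; have i_lt := ltn_ord i; have j_lt := ltn_ord j.
  (* Without wrap-around the difference is [j]; otherwise it is [n - j] for the order [n] of the
     graph, which is coprime to [n] exactly when [j] is. *)
  have [ij_lt|ij_ge] := ltnP (i + j) n.+1.
    by rewrite modn_small //; congr (coprime _ _); lia.
  rewrite -{1}(subnK ij_ge) modnDr modn_small; last by lia.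
  rewrite (_ : absz _ = n.+1 - j)%N; last by lia.
  exact/coprime_subl/ltnW.
exists #|[set j : 'I_n.+1 | unitary_cayley_adj 0 j]| => i.
rewrite -(card_imset _ (addrI (i : 'I_n.+1))).
apply: eq_card => j; rewrite inE; apply/idP/imsetP => [ij|[j' j'P ->]].
  by exists (j - i : 'I_n.+1); rewrite ?inE /= -?(shift i) addrC subrK.
by move: j'P; rewrite inE /= -(shift i).
Qed.

(** The witness is 2 for odd [n], and otherwise the odd one of [n/2 - 2] and [n/2 - 1]: its gcd with
    [n/2] divides 2 or 1. For [n = 6] it would be 1. *)
Lemma exists_coprime_middle n : (4 < n)%N -> n != 6%N ->
  exists b, [/\ (1 < b)%N, (b.+1 < n)%N & coprime b n].
Proof.
move=> n_gt4 n6; case: (boolP (odd n)) => [n_odd|n_even].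
  by exists 2%N; split; [|lia|rewrite coprime2n].
have n2 : n = (n./2 * 2)%N by lia.
have [h_odd|h_even] := boolP (odd n./2).
  have [c hc] : exists c, n./2 = (c + 2)%N by exists (n./2 - 2)%N; lia.
  have c_odd : odd c by lia.
  exists c; split; [lia|lia|]; rewrite n2 coprimeMr coprimen2 c_odd andbT hc.
  by rewrite /coprime gcdnDl -/(coprime _ _) coprimen2.
have [c hc] : exists c, n./2 = (c + 1)%N by exists (n./2 - 1)%N; lia.
have c_odd : odd c by lia.
exists c; split; [lia|lia|]; rewrite n2 coprimeMr coprimen2 c_odd andbT hc.
by rewrite /coprime gcdnDl gcdn1.
Qed.

(* For these [n], the units modulo [n] are [1] and [-1]. *)
Lemma unitary_cayley_adj_cycle n (i j : 'I_n) : n \in [:: 3; 4; 6] ->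
  unitary_cayley_adj i j = ((i + 1) %% n == j)%N || ((j + 1) %% n == i)%N.
Proof.
move: i j => [i i_lt] [j j_lt]; rewrite !inE => /or3P[] /eqP n_eq; subst n.
- by move: i j i_lt j_lt => [|[|[|]]] // [|[|[|]]].
- by move: i j i_lt j_lt => [|[|[|[|]]]] // [|[|[|[|]]]].
- by move: i j i_lt j_lt => [|[|[|[|[|[|]]]]]] // [|[|[|[|[|[|]]]]]].
Qed.

Lemma unitary_cayley_is_cycle n : n \in [:: 3; 4; 6] ->
  exists w : nat -> unitary_cayley n, is_cycle n w.
Proof.
case: n => // n n_in.
pose w i : unitary_cayley n.+1 := Ordinal (ltn_pmod i (ltn0Sn n)).
have w_adj i j : adj (w i) (w j) =
    (i.+1 == j %[mod n.+1]) || (j.+1 == i %[mod n.+1]).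
  rewrite -(addn1 i) -(addn1 j) -(modnDml i) -(modnDml j).
  exact: (unitary_cayley_adj_cycle (w i) (w j) n_in).
exists w; split=> // [|v]; last first.
  by exists (val v); apply: val_inj; rewrite /= modn_small.
split=> [i|i j]; last by rewrite -val_eqE.
by rewrite w_adj eqxx.
Qed.

(** Consecutive differences around 0, 1, [b + 1], [b] are 1, [b], 1, [b] up to sign, all coprime to
    [n]. *)
Lemma unitary_cayley_cycle4 n b : (1 < b)%N -> (b.+1 < n)%N -> coprime b n ->
  exists w : nat -> unitary_cayley n, cycle_in 4 w.
Proof.
move=> b_gt1 b_lt b_n; have n_gt1 : (1 < n)%N by lia.
pose s := [:: 0; 1; b.+1; b]%N.
have s_lt i : (nth 0 s i < n)%N by move: i => [|[|[|[|[|i]]]]] /=; lia.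
pose w i : unitary_cayley n := Ordinal (s_lt (i %% 4)%N).
exists w; split=> [i|i j].
  rewrite unitary_cayley_adjE // /w /= -[i.+1]addn1 -(modnDml i).
  have := ltn_pmod i (isT : (0 < 4)%N).
  case: (i %% 4)%N => [|[|[|[|]]]] //= _.
  - exact: coprime1n.
  - by rewrite (_ : absz _ = b) //; lia.
  - by rewrite (_ : absz _ = 1%N) ?coprime1n //; lia.
  - by rewrite addn0.
rewrite -val_eqE /=.
have := ltn_pmod i (isT : (0 < 4)%N); have := ltn_pmod j (isT : (0 < 4)%N).
by case: (i %% 4)%N => [|[|[|[|]]]] //=; case: (j %% 4)%N => [|[|[|[|]]]] //=; lia.
Qed.

(* C is an arbitrary model of the complex numbers, e.g. algC or R[i]. *)
Theorem theorem3p8 (C : numClosedFieldType) (n : nat) (n_gt0 : (0 < n)%N) :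
  strongly_regular C (line_graph (line_graph (unitary_cayley n))) <-> n = 4%N.
Proof.
(* The line graph of a cycle is a cycle of the same length, so for these [n] everything reduces to
   the cycle itself. *)
have cycle2 : n \in [:: 3; 4; 6] ->
    exists w : nat -> line_graph (line_graph (unitary_cayley n)), is_cycle n w.
  move=> n_in; have n_gt2 : (2 < n)%N by case/or4P: n_in => // /eqP->.
  have [w /(line_is_cycle n_gt2)[w' /(line_is_cycle n_gt2)]] :=
    unitary_cayley_is_cycle n_in.
  by [].
split=> [[[L2_gt0 _] _ eig3]|n4]; last first.
  by subst n; have [//|w] := cycle2 _; exact: cycle4_strongly_regular.
have [n_le2|n_gt2] := leqP n 2.
  (* At most two vertices span at most one edge, so [L^2] is empty, whereas [connected] demands a
     vertex. *)
  have L1_le : (#|line_graph (unitary_cayley n)| <= 1)%N.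
    apply: leq_trans (card_line_graph _) _.
    by rewrite /= card_ord; case: (n) n_le2 => [|[|[|]]].
  have := leq_trans L2_gt0 (card_line_graph _).
  by case: #|_| L1_le => [|[|]].
have [n3|n3] := eqVneq n 3%N.
  by subst n; have [//|w] := cycle2 _; case/cycle3_not_three_eigenvalues/(_ eig3).
have [n6|n6] := eqVneq n 6%N.
  by subst n; have [//|w] := cycle2 _; case/cycle6_not_three_eigenvalues/(_ eig3).
have [//|n4] := eqVneq n 4%N.
have n_gt4 : (4 < n)%N by lia.
have [b [b_gt1 b_lt b_n]] := exists_coprime_middle n_gt4 n6.
have [w wC] := unitary_cayley_cycle4 b_gt1 b_lt b_n.
have n_gt1 : (1 < n)%N by lia.
have [k Xk] := unitary_cayley_regular n_gt1.
have ltb : (b < n)%N by lia.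
have ltn1 : (n.-1 < n)%N by lia.
(* The vertices 1, [b] and [n - 1] are three distinct neighbours of 0. *)
have k_gt2 : (2 < k)%N.
  rewrite -(Xk (Ordinal n_gt0)).
  pose B := [:: Ordinal n_gt1; Ordinal ltb; Ordinal ltn1] : seq (unitary_cayley n).
  have B_uniq : uniq B by rewrite /= !inE -!val_eqE /=; lia.
  apply: (@leq_trans (size B)) => //.
  rewrite -(card_uniqP B_uniq); apply: subset_leq_card.
  apply/subsetP => v; rewrite !inE => vB.
  rewrite unitary_cayley_adj_le // subn0.
  case/or3P: vB => /eqP-> //=; first exact: coprime1n.
  by rewrite coprime_sym coprimenP.
by case: (line2_not_three_eigenvalues Xk k_gt2 wC _ _ eig3).
Qed.
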